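(* Let $\alpha>-1$, $\beta>-1$ and, for $n\ge 1$, put $$\gamma_n=-\frac{2(\alpha+n)(n+\alpha+\beta+1)}{(2n+\alpha+\beta+1)(2n+\alpha+\beta)} .$$ Then: (i) $(\gamma_n)$ satisfies, for all $n\ge2$, the nonlinear difference equation $$c^c_{n+1}-c^c_n+\gamma_n-\gamma_{n+1}-\frac{\lambda^c_{n+1}}{\gamma_n}+\frac{\lambda^c_n}{\gamma_{n-1}}=0 .$$ (ii) For all $n\ge1$, the quasi-Christoffel Jacobi polynomial $J^{QC}_n(x;-1)=\mathcal P^{(\alpha,\beta+1)}_n(x)+\gamma_n\mathcal P^{(\alpha,\beta+1)}_{n-1}(x)$ equals $(x-1)\,\mathcal P^{(\alpha+1,\beta+1)}_{n-1}(x)$. (iii) For all $n\ge2$, $$J^{QC}_{n+1}(x;-1)=(x-c^{qc}_{n+1})J^{QC}_n(x;-1)-\lambda^{qc}_{n+1}J^{QC}_{n-1}(x;-1),$$ where $$\lambda^{qc}_{n+1}=\frac{4(n-1)(n+\alpha)(n+\beta)(n+\alpha+\beta+1)}{(2n+\alpha+\beta)^2(2n+\alpha+\beta+1)(2n+\alpha+\beta-1)},\qquad c^{qc}_{n+1}=\frac{(\beta-\alpha)(2+\beta+\alpha)}{(2n+\alpha+\beta)(2n+\alpha+\beta+2)} .$$ (iv) The polynomials $J^{QC}_n(x;-1)$, $n\ge1$, are orthogonal with respect to $d\mu_1(x)=(1-x)^{\alpha-1}(1+x)^{\beta+1}\,dx$ on $(-1,1)$.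
   Context: For $a,b>-1$, $\mathcal P^{(a,b)}_n(x)$ denotes the monic Jacobi polynomial of degree $n$, i.e. the monic polynomials orthogonal on $(-1,1)$ with respect to the weight $(1-x)^a(1+x)^b$. The polynomials $\mathcal P^{(\alpha,\beta+1)}_n$ (the Christoffel transform at $-1$ of $\mathcal P^{(\alpha,\beta)}_n$) satisfy $\mathcal P^{(\alpha,\beta+1)}_{n+1}(x)=(x-c^c_{n+1})\mathcal P^{(\alpha,\beta+1)}_n(x)-\lambda^c_{n+1}\mathcal P^{(\alpha,\beta+1)}_{n-1}(x)$ for $n\ge1$ with $$\lambda^c_{n+1}=\frac{4n(n+\alpha)(n+\beta+1)(n+\alpha+\beta+1)}{(2n+\alpha+\beta+1)^2(2n+\alpha+\beta+2)(2n+\alpha+\beta)},\qquad c^c_{n+1}=\frac{(\beta+1)^2-\alpha^2}{(2n+\alpha+\beta+1)(2n+\alpha+\beta+3)} .$$ A family of polynomials $(p_n)_{n\ge n_0}$ is orthogonal with respect to a measure $\mu$ if $\int p_np_m\,d\mu$ converges absolutely for all $n,m\ge n_0$, is $0$ for $n\ne m$ and is nonzero for $n=m$. *)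

(* Defs.v *)
From HB Require Import structures.
From mathcomp Require Import all_boot all_order all_algebra.
From mathcomp Require Import all_classical all_reals all_analysis.
From mathcomp Require Import measurable_realfun.

Set Implicit Arguments.
Unset Strict Implicit.
Unset Printing Implicit Defensive.

Import Order.TTheory GRing.Theory Num.Theory.
Import numFieldNormedType.Exports.

Local Open Scope classical_set_scope.
Local Open Scope ring_scope.

Definition orthogonal_family (R : realType)
    (mu : {measure set (measurableTypeR R) -> \bar R}) (n0 : nat)
    (p : nat -> {poly R}) : Prop :=
  forall n m : nat, (n0 <= n)%N -> (n0 <= m)%N ->
    [/\ mu.-integrable [set: measurableTypeR R]
          (fun x => ((p n).[x] * (p m).[x])%:E),
        n <> m -> (\int[mu]_x ((p n).[x] * (p m).[x])%:E = 0)%E &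
        n = m -> (\int[mu]_x ((p n).[x] * (p m).[x])%:E <> 0)%E].

Definition jacobi_weight (R : realType) (a b x : R) : R :=
  (1 - x) `^ a * (1 + x) `^ b.

(* The exponents are arbitrary: the total mass is infinite when a <= -1 or
   b <= -1. *)
Definition jacobi_measure (R : realType) (a b : R)
    (A : set (measurableTypeR R)) : \bar R :=
  (\int[@lebesgue_measure R]_(x in A `&` `](-1)%R, 1%R[)
    (jacobi_weight a b x)%:E)%E.

Section jacobi_measure_is_measure.
Context (R : realType) (a b : R).

Let jacobi_weight_ge0 (x : R) : 0 <= jacobi_weight a b x.
Proof. by rewrite mulr_ge0// powR_ge0. Qed.

Lemma measurable_jacobi_weight :
  measurable_fun [set: measurableTypeR R] (jacobi_weight a b).
Proof.
apply: measurable_funM.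
- apply: (measurableT_comp (measurable_powR _)).
  exact: measurable_funB.
- apply: (measurableT_comp (measurable_powR _)).
  exact: measurable_funD.
Qed.

Let jacobi_measure0 : jacobi_measure a b set0 = 0%E.
Proof. by rewrite /jacobi_measure set0I integral_set0. Qed.

Let jacobi_measure_ge0 A : (0 <= jacobi_measure a b A)%E.
Proof. by apply: integral_ge0 => x _; rewrite lee_fin. Qed.

Let jacobi_measure_sigma_additive :
  semi_sigma_additive (jacobi_measure a b).
Proof.
move=> F mF tF mUF; rewrite /jacobi_measure setI_bigcupl.
have mFI i : measurable (F i `&` `]-1, 1[) by exact: measurableI.
rewrite ge0_integral_bigcup//.
- by apply: is_cvg_ereal_nneg_natsum_cond => n _ _; exact: jacobi_measure_ge0.
- apply/measurable_EFinP; apply: measurable_funTS.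
  exact: measurable_jacobi_weight.
- by move=> x _; rewrite lee_fin.
- exact: trivIset_setIr.
Qed.

HB.instance Definition _ := isMeasure.Build _ _ _ (jacobi_measure a b)
  jacobi_measure0 jacobi_measure_ge0 jacobi_measure_sigma_additive.

End jacobi_measure_is_measure.

Definition is_monic_jacobi (R : realType) (a b : R) (P : nat -> {poly R}) :
    Prop :=
  (forall n, P n \is monic /\ size (P n) = n.+1) /\
  orthogonal_family (jacobi_measure a b) 0 P.

(* For a, b > -1 exactly one sequence satisfies is_monic_jacobi a b; otherwise
   none does and the value is the zero sequence. *)
Definition jacobi (R : realType) (a b : R) : nat -> {poly R} :=
  xget (fun=> 0) [set P | is_monic_jacobi a b P].

Section coefficients.
Context (R : realType) (alpha beta : R).

(* The formulas for the recurrence coefficients are given for the index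
   n + 1; hence the shift n := k - 1 below. *)

Definition lambda_c (k : nat) : R :=
  let n := k%:R - 1 in
  4 * n * (n + alpha) * (n + beta + 1) * (n + alpha + beta + 1) /
  ((2 * n + alpha + beta + 1) ^+ 2 * (2 * n + alpha + beta + 2) *
   (2 * n + alpha + beta)).

Definition c_c (k : nat) : R :=
  let n := k%:R - 1 in
  ((beta + 1) ^+ 2 - alpha ^+ 2) /
  ((2 * n + alpha + beta + 1) * (2 * n + alpha + beta + 3)).

Definition gamma_ (n : nat) : R :=
  - (2 * (alpha + n%:R) * (n%:R + alpha + beta + 1) /
     ((2 * n%:R + alpha + beta + 1) * (2 * n%:R + alpha + beta))).

Definition lambda_qc (k : nat) : R :=
  let n := k%:R - 1 in
  4 * (n - 1) * (n + alpha) * (n + beta) * (n + alpha + beta + 1) /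
  ((2 * n + alpha + beta) ^+ 2 * (2 * n + alpha + beta + 1) *
   (2 * n + alpha + beta - 1)).

Definition c_qc (k : nat) : R :=
  let n := k%:R - 1 in
  (beta - alpha) * (2 + beta + alpha) /
  ((2 * n + alpha + beta) * (2 * n + alpha + beta + 2)).

(* Meaningful for n >= 1 only. *)
Definition J_qc (n : nat) : {poly R} :=
  jacobi alpha (beta + 1) n + gamma_ n *: jacobi alpha (beta + 1) n.-1.

End coefficients.

(* Main.v *)
Require Import Defs.
From HB Require Import structures.
From mathcomp Require Import all_boot all_order all_algebra.
From mathcomp Require Import all_classical all_reals all_analysis.
From mathcomp Require Import measurable_realfun.
From mathcomp Require Import ring lra zify.

Set Implicit Arguments.
Unset Strict Implicit.
Unset Printing Implicit Defensive.

Import Order.TTheory GRing.Theory Num.Theory.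
Import numFieldNormedType.Exports.

Local Open Scope classical_set_scope.
Local Open Scope ring_scope.

(** Write L_(a,b) for the functional sending a polynomial p to the integral of
    p(x) (1-x)^a (1+x)^b over (-1,1), where a, b > -1.  Polynomials are
    integrable for this weight, and the proof rests on four further facts: L is
    linear; it is positive at 1; raising an exponent by one amounts to
    multiplying the argument by 1 - x or 1 + x; and the Pearson identity
    [jacobi_functional_raise] holds, that is, L vanishes on the polynomials
    q* for which q* (1-x)^a (1+x)^b is the derivative of
    q (1-x)^(a+1) (1+x)^(b+1), since that product tends to 0 at both end points.

    Integration by parts then says that q -> q* is, up to sign, adjoint to
    differentiation, viewed as a map between the parameters (a+1,b+1) and
    (a,b).  Iterating it from the constant 1 (the formula of Rodrigues) gives
    polynomials [jacobi_poly] which are orthogonal to everything of smaller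
    degree and have positive norms, by induction on the degree; normalised to
    be monic, they form the unique sequence defining [jacobi] ([jacobiE]).
    The same recursion yields closed forms for the coefficients following the
    leading one.

    A polynomial of degree at most n which is orthogonal to all smaller degrees
    is a multiple of P_n ([jacobi_poly_unique]), and the multiple is read off
    from the coefficient of x^n.  Applied to (x-1) P^(a+1,b)_n - P^(a,b)_(n+1),
    this gives the connection formula [christoffel_jacobi_poly], which is (ii)
    because gamma is the resulting difference of coefficients; applied to
    (x - c) P_(n+1) - P_(n+2), it gives the three-term recurrence, and (iii) is
    that recurrence for the parameters (alpha+1, beta+1) multiplied by x - 1.
    Part (iv) holds because the square of x - 1 turns the weight with exponent
    alpha - 1 into the one with exponent alpha + 1; part (i) is an identity
    between rational functions. *)

(** * Integration against the Jacobi measure *)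

Section density.
Context (R : realType) (a b : R).
Local Notation mu := (@lebesgue_measure R).
Local Notation w := (jacobi_weight a b).
Local Notation D := (`](-1)%R, 1%R[%classic : set R).

Import HBNNSimple.

Lemma jacobi_weight_ge0 (x : R) : 0 <= w x.
Proof. by rewrite mulr_ge0// powR_ge0. Qed.

Let mw : measurable_fun D (EFin \o w).
Proof.
apply/measurable_EFinP; apply: measurable_funTS.
exact: measurable_jacobi_weight.
Qed.

(** The standard passage from indicators to nonnegative functions: both sides
    are monotone limits over the same simple functions. *)
Lemma ge0_integral_jacobi (f : measurableTypeR R -> \bar R) :
  (forall x, 0 <= f x)%E -> measurable_fun [set: measurableTypeR R] f ->
  (\int[jacobi_measure a b]_x f x = \int[mu]_(x in D) (f x * (w x)%:E))%E.
Proof.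
move=> f0 mf.
pose h := nnsfun_approx measurableT mf.
have hf x : EFin \o h ^~ x @ \oo --> f x by exact: cvg_nnsfun_approx.
transitivity (limn (fun n => \int[jacobi_measure a b]_x (h n x)%:E)%E).
  under eq_integral => x _ do rewrite -(cvg_lim _ (hf x))//.
  apply: monotone_convergence => //.
  - by move=> n; exact/measurable_EFinP.
  - by move=> n x _; rewrite lee_fin.
  - by move=> x _ m n mn; rewrite lee_fin; exact/lefP/nd_nnsfun_approx.
transitivity (limn (fun n =>
    \int[mu]_(x in D) ((h n x)%:E * (w x)%:E))%E); last first.
  rewrite -monotone_convergence//=.
  - apply: eq_integral => x _; apply: cvg_lim => //.
    by apply: cvgeZr => //; exact: hf.
  - move=> n; apply: emeasurable_funM => //.
    by apply/measurable_funTS/measurable_EFinP.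
  - by move=> n x _; rewrite mule_ge0// lee_fin// jacobi_weight_ge0.
  - move=> x _ m n mn; rewrite lee_wpmul2r ?lee_fin ?jacobi_weight_ge0//.
    exact/lefP/nd_nnsfun_approx.
congr (limn _); apply/funext => n.
rewrite integralT_nnsfun sintegralE.
have -> : (\int[mu]_(x in D) ((h n x)%:E * (w x)%:E) =
  \int[mu]_(x in D) \sum_(y \in range (h n))
     (y%:E * ((\1_(h n @^-1` [set y]) x)%:E * (w x)%:E)))%E.
  apply: eq_integral => x _.
  rewrite fimfunE -fsumEFin// ge0_mule_fsuml.
    by apply: eq_fsbigr => y _; rewrite EFinM muleA.
  by move=> y; exact: nnfun_muleindic_ge0.
have mi y : measurable_fun D
    (fun x => (\1_(h n @^-1` [set y]) x)%:E * (w x)%:E)%E.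
  apply: emeasurable_funM => //; apply/measurable_EFinP.
  by apply: measurable_indic => //; apply: (measurable_funPTI (h n)).
rewrite ge0_integral_fsum//; last 2 first.
  - move=> y; exact: (measurable_funeM y%:E (mi y)).
  - move=> y x _; rewrite muleA mule_ge0//; last first.
      by rewrite lee_fin jacobi_weight_ge0.
    by rewrite -EFinM; exact: nnfun_muleindic_ge0.
apply: eq_fsbigr => y; rewrite inE => -[x0 _ hy].
rewrite ge0_integralZl//; last 3 first.
- exact: (mi y).
- by move=> x _; rewrite mule_ge0// lee_fin// jacobi_weight_ge0.
- by rewrite lee_fin -hy.
congr (_ * _)%E.
rewrite /= /jacobi_measure setIC integral_mkcondr.
by apply: eq_integral => x _; rewrite epatch_indic muleC.
Qed.

(** Multiplication by the nonnegative weight commutes with taking positive and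
    negative parts, whose integrals agree even when they are infinite. *)
Lemma integral_jacobi (f : measurableTypeR R -> R) :
  measurable_fun [set: measurableTypeR R] f ->
  (\int[jacobi_measure a b]_x (f x)%:E = \int[mu]_(x in D) (f x * w x)%:E)%E.
Proof.
move=> mf; have mfE : measurable_fun [set: measurableTypeR R] (EFin \o f).
  exact/measurable_EFinP.
rewrite integralE [RHS]integralE.
rewrite ge0_integral_jacobi//; last exact: measurable_funepos.
rewrite ge0_integral_jacobi//; last exact: measurable_funeneg.
congr (_ - _)%E; apply: eq_integral => x _.
  rewrite !funeposE -EFin_max -EFinM -EFin_max maxr_pMl// ?mul0r//.
  exact: jacobi_weight_ge0.
rewrite !funenegE -!EFinN -EFin_max -EFinM -EFin_max maxr_pMl ?mul0r ?mulNr//.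
exact: jacobi_weight_ge0.
Qed.

Lemma integrable_jacobi (f : measurableTypeR R -> R) :
  measurable_fun [set: measurableTypeR R] f ->
  mu.-integrable D (fun x => (f x * w x)%:E) ->
  (jacobi_measure a b).-integrable [set: measurableTypeR R] (fun x => (f x)%:E).
Proof.
move=> mf /integrableP[_ fw]; apply/integrableP; split.
  exact/measurable_EFinP.
rewrite ge0_integral_jacobi//; last first.
  by apply: measurableT_comp => //; exact/measurable_EFinP.
rewrite (eq_integral (fun x => `|(f x * w x)%:E|%E))// => x _.
by rewrite /= normrM (ger0_norm (jacobi_weight_ge0 x)).
Qed.

End density.

(** * Improper integrals over (-1,1) *)

Section improper_integrals.
Context (R : realType).

(** The open interval is exhausted by the segments with end points - r_ n and
    r_ n, on which the integrands are continuous. *)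
Let r_ (n : nat) : R := 1 - n.+2%:R^-1.

Local Notation mu := (@lebesgue_measure R).
Local Notation D := (`](-1)%R, 1%R[%classic : set R).
Local Notation E n := (`[- r_ n, r_ n]%classic : set R).

Let r_gt0 n : 0 < r_ n.
Proof. by rewrite /r_ subr_gt0 invf_lt1// ltr1n. Qed.

Let r_lt1 n : r_ n < 1.
Proof. by rewrite /r_ ltrBlDr ltrDl invr_gt0. Qed.

Let sub_E_D n : E n `<=` D.
Proof.
move=> x /=; rewrite !in_itv/= => /andP[x1 x2].
by have := r_lt1 n; move: x1 x2 => *; apply/andP; split; lra.
Qed.

Let cvg_r : r_ n @[n --> \oo] --> (1 : R).
Proof.
rewrite -[X in _ --> X](subr0 1); apply: cvgB; first exact: cvg_cst.
by have := @cvg_harmonic R; rewrite -cvg_shiftS.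
Qed.

Let E_near x : D x -> \forall n \near \oo, E n x.
Proof.
rewrite /= in_itv/= => /andP[x1 x2].
have xlt1 : `|x| < 1 by rewrite ltr_norml x1.
have : \forall n \near \oo, `|x| < r_ n.
  exact: (cvgr_gt 1 cvg_r).
apply: filterS => n /ltW; rewrite ler_norml => /andP[h1 h2].
by rewrite /= in_itv/= h1.
Qed.

Lemma integral_symmetric_cut (F f : R -> R) n :
  (forall x, D x -> is_derive x 1 F (f x)) ->
  (forall x, D x -> derivable f x 1) ->
  (\int[mu]_(x in E n) (f x)%:E = (F (r_ n))%:E - (F (- r_ n))%:E)%E.
Proof.
move=> dF df; have cutlt : - r_ n < r_ n by have := r_gt0 n; lra.
have FD x : D x -> derivable F x 1 by move=> /dF [].
apply: continuous_FTC2 => //.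
- by apply: derivable_within_continuous => x xE; apply: df; exact: (sub_E_D xE).
- have : {within `[- r_ n, r_ n], continuous F}.
    by apply: derivable_within_continuous => x xE; apply: FD;
       exact: (sub_E_D xE).
  move=> /(continuous_within_itvP F cutlt)[_ Fl Fr]; split => //.
  move=> x xE; apply: FD; apply: (@sub_E_D n).
  exact: subset_itv_oo_cc xE.
- move=> x xE; rewrite derive1E; apply/derive_val/dF; apply: (@sub_E_D n).
  exact: subset_itv_oo_cc xE.
Qed.

(** Dominated convergence along the symmetric cuts: the integrand itself may
    blow up at the end points, only the primitive has limits there. *)
Lemma integral_oo_FTC (F f : R -> R) (l1 l2 : R) :
  mu.-integrable D (EFin \o f) ->
  (forall x, D x -> is_derive x 1 F (f x)) ->
  (forall x, D x -> derivable f x 1) ->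
  F x @[x --> (-1)^'+] --> l1 -> F x @[x --> 1^'-] --> l2 ->
  (\int[mu]_(x in D) (f x)%:E = l2%:E - l1%:E)%E.
Proof.
move=> intf dF df Fl1 Fl2.
have mf := measurable_int _ intf.
have cut_lim : (\int[mu]_(x in E n) (f x)%:E)%E @[n --> \oo] -->
    (l2%:E - l1%:E)%E.
  rewrite -EFinB.
  under eq_fun do rewrite (integral_symmetric_cut _ dF df) -EFinB.
  apply: cvg_EFin; first by near=> n.
  apply: cvgB.
    by move/cvg_at_leftP: Fl2; apply; split.
  move/cvg_at_rightP: Fl1; apply; split; last by apply: cvgN; exact: cvg_r.
  by move=> n; rewrite ltrN2.
suff : (\int[mu]_(x in E n) (f x)%:E)%E @[n --> \oo] -->
    (\int[mu]_(x in D) (f x)%:E)%E.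
  by move=> h; apply: (cvg_unique _ h cut_lim).
have [] // := @dominated_convergence _ _ _ mu D _
  (fun n => (EFin \o f) \_ (E n)) (EFin \o f) (fun x => `|(f x)%:E|%E).
- move=> n; apply/(measurable_restrict _ _ _) => //.
  by apply: measurable_funS mf => //; exact: subIsetl.
- apply: aeW => x Dx; apply: cvg_near_cst.
  by apply: filterS (E_near Dx) => n En; rewrite patchE mem_set.
- exact: integrable_abse.
- apply: aeW => x n Dx; rewrite patchE; case: ifPn => //.
  by rewrite abse0.
move=> _ _; apply: cvg_trans; apply: near_eq_cvg; apply: nearW => n.
by rewrite /= -integral_mkcondr setIidr//; exact: sub_E_D.
Unshelve. all: by end_near. Qed.

(** The integrals over the symmetric cuts increase and are bounded by 2 K. *)
Lemma integrable_oo_bounded_primitive (F f : R -> R) (K : R) :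
  measurable_fun D f ->
  (forall x, D x -> 0 <= f x) ->
  (forall x, D x -> is_derive x 1 F (f x)) ->
  (forall x, D x -> derivable f x 1) ->
  (forall x, D x -> `|F x| <= K) ->
  mu.-integrable D (EFin \o f).
Proof.
move=> mf f0 dF df FK; apply/integrableP; split; first exact/measurable_EFinP.
rewrite (_ : integral _ _ _ = \int[mu]_(x in D) (f x)%:E)%E; last first.
  apply: eq_integral.
  by move=> x /[!inE] Dx /=; rewrite ger0_norm// f0.
apply: (@le_lt_trans _ _ (2 * K)%:E); last exact: ltry.
have DE : D = \bigcup_n E n.
  apply/seteqP; split => [x Dx|x [n _]]; last exact: sub_E_D.
  by have [n _ /(_ n (leqnn _))] := E_near Dx; exists n.
have cvgE : (\int[mu]_(x in E n) (f x)%:E)%E @[n --> \oo] -->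
    (\int[mu]_(x in D) (f x)%:E)%E.
  rewrite [X in _ --> (\int[_]_(x in X) _)%E]DE.
  apply: ge0_nondecreasing_set_cvg_integral => //.
  - move=> m n mn; apply/subsetPset; apply: subset_itv; rewrite bnd_simp.
      by rewrite lerN2 lerB// lef_pV2 ?posrE// ler_nat !ltnS.
    by rewrite lerB// lef_pV2 ?posrE// ler_nat !ltnS.
  - by move=> n; apply/measurable_EFinP; apply: measurable_funS mf.
  - by move=> n x /sub_E_D Dx; rewrite lee_fin f0.
rewrite -(cvg_lim _ cvgE)//; apply: lime_le.
  by apply/cvg_ex; eexists; exact: cvgE.
near=> n.
rewrite (integral_symmetric_cut _ dF df) -EFinB lee_fin.
have h1 : D (r_ n) by apply: (@sub_E_D n);
  rewrite /= in_itv/= lexx andbT; have := r_gt0 n; lra.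
have h2 : D (- r_ n) by apply: (@sub_E_D n);
  rewrite /= in_itv/= lexx; have := r_gt0 n; lra.
have := FK _ h1; have := FK _ h2; rewrite !ler_norml => /andP[? ?] /andP[? ?].
by lra.
Unshelve. all: by end_near. Qed.

End improper_integrals.

(** * The Jacobi functional and the Pearson identity *)

Section jacobi_functional.
Context (R : realType).
Local Notation mu := (@lebesgue_measure R).
Local Notation D := (`](-1)%R, 1%R[%classic : set R).
Implicit Types (a b x : R) (p q : {poly R}).

Let D_gt0 x : D x -> 0 < 1 - x /\ 0 < 1 + x.
Proof. by rewrite /= in_itv/= => /andP[? ?]; split; lra. Qed.

Lemma jacobi_weight_gt0 a b x : D x -> 0 < jacobi_weight a b x.
Proof. by move=> /D_gt0[? ?]; rewrite mulr_gt0// powR_gt0. Qed.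

Lemma jacobi_weightSl a b x : D x ->
  jacobi_weight (a + 1) b x = (1 - x) * jacobi_weight a b x.
Proof.
move=> /D_gt0[x1 _]; rewrite /jacobi_weight powRD; last first.
  by rewrite (gt_eqF x1) implybT.
by rewrite powRr1 ?ltW//; ring.
Qed.

Lemma jacobi_weightSr a b x : D x ->
  jacobi_weight a (b + 1) x = (1 + x) * jacobi_weight a b x.
Proof.
move=> /D_gt0[_ x1]; rewrite /jacobi_weight powRD; last first.
  by rewrite (gt_eqF x1) implybT.
by rewrite powRr1 ?ltW//; ring.
Qed.

Lemma is_derive_powR_onem a x : 0 < 1 - x ->
  is_derive x 1 (fun y => (1 - y) `^ a) (- (a * (1 - x) `^ (a - 1))).
Proof.
move=> x1.
have h : is_derive x 1 (fun y : R => 1 - y) (- 1 : R).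
  change (is_derive x 1 (cst (1 : R) - id) (- 1 : R)).
  by apply: is_derive_eq; rewrite sub0r.
have h2 := @is_derive1_powR R a (1 - x) x1.
have hc := is_derive1_comp (f := @powR R ^~ a) (g := fun y : R => 1 - y) h2 h.
apply: is_derive_eq.
by rewrite mulrN1.
Qed.

Lemma is_derive_powR_onep a x : 0 < 1 + x ->
  is_derive x 1 (fun y => (1 + y) `^ a) (a * (1 + x) `^ (a - 1)).
Proof.
move=> x1.
have h : is_derive x 1 (fun y : R => 1 + y) (1 : R).
  change (is_derive x 1 (cst (1 : R) + id) (1 : R)).
  by apply: is_derive_eq; rewrite add0r.
have h2 := @is_derive1_powR R a (1 + x) x1.
have hc := is_derive1_comp (f := @powR R ^~ a) (g := fun y : R => 1 + y) h2 h.
apply: is_derive_eq.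
by rewrite mulr1.
Qed.

(** The first-order operator defined by
    (q (1-x)^(a+1) (1+x)^(b+1))' = jacobi_raise a b q (1-x)^a (1+x)^b. *)
Definition jacobi_raise a b q : {poly R} :=
  (1 - 'X^2) * q^`() + ((b - a)%:P - (a + b + 2) *: 'X) * q.

Lemma is_derive_jacobi_raise a b q x : D x ->
  is_derive x 1 (fun y => q.[y] * jacobi_weight (a + 1) (b + 1) y)
    ((jacobi_raise a b q).[x] * jacobi_weight a b x).
Proof.
move=> Dx; have [x1 x2] := D_gt0 Dx.
have hq : is_derive x 1 (horner q) (q^`()).[x].
  by apply: DeriveDef; [exact: derivable_horner|rewrite derivE derive1E].
have hl := is_derive_powR_onem (a + 1) x1.
have hr := is_derive_powR_onep (b + 1) x2.
change (is_derive x 1 (horner q * ((fun y => (1 - y) `^ (a + 1)) *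
  (fun y => (1 + y) `^ (b + 1))))
  ((jacobi_raise a b q).[x] * jacobi_weight a b x)).
apply: is_derive_eq.
rewrite /jacobi_weight /jacobi_raise !addrK mulrfctE.
rewrite !powRD ?(gt_eqF x1) ?(gt_eqF x2) ?implybT// !powRr1 ?ltW//.
rewrite !hornerE /GRing.scale /=.
ring.
Qed.

Lemma derivable_jacobi_weight a b q x : D x ->
  derivable (fun y => q.[y] * jacobi_weight a b y) x 1.
Proof.
by move=> /(is_derive_jacobi_raise (a - 1) (b - 1) q)[]; rewrite !subrK.
Qed.

Lemma le_powR_norm a x : 1 <= x -> x <= 2 -> x `^ a <= 2 `^ `|a|.
Proof.
move=> x1 x2; apply: (@le_trans _ _ (x `^ `|a|)).
  by apply: ler_powR => //; exact: ler_norm.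
by apply: ge0_ler_powR => //; rewrite nnegrE; lra.
Qed.

(** On each half of the interval one of the two factors is a power of a number
    between 1 and 2, hence is bounded; the sum on the right has an
    explicit bounded primitive. *)
Lemma jacobi_weight_le a b x : D x ->
  jacobi_weight a b x <=
    (2 `^ `|a| + 2 `^ `|b|) * ((1 - x) `^ a + (1 + x) `^ b).
Proof.
move=> Dx; have [x1 x2] := D_gt0 Dx.
have A := powR_ge0 (1 - x) a; have B := powR_ge0 (1 + x) b.
have C := powR_ge0 2 `|a|; have C' := powR_ge0 2 `|b|.
rewrite /jacobi_weight; have [x0|x0] := leP 0 x.
- have : (1 + x) `^ b <= 2 `^ `|b| by apply: le_powR_norm; lra.
  nra.
- have : (1 - x) `^ a <= 2 `^ `|a| by apply: le_powR_norm; lra.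
  nra.
Qed.

Lemma powR_le2 a x : 0 < a -> 0 < x -> x < 2 -> x `^ a <= 2 `^ a.
Proof.
by move=> a0 x0 x2; apply: ge0_ler_powR; rewrite ?nnegrE; lra.
Qed.

Lemma integrable_jacobi_weight a b : -1 < a -> -1 < b ->
  mu.-integrable D (fun x => (jacobi_weight a b x)%:E).
Proof.
move=> a1 b1; have a0 : 0 < a + 1 by lra. have b0 : 0 < b + 1 by lra.
pose g x := (1 - x) `^ a + (1 + x) `^ b.
pose G x := (b + 1)^-1 * (1 + x) `^ (b + 1) - (a + 1)^-1 * (1 - x) `^ (a + 1).
have dl c x : D x -> derivable (fun y : R => (1 - y) `^ c) x 1.
  by move=> /D_gt0[/is_derive_powR_onem-/(_ c)[]].
have dr c x : D x -> derivable (fun y : R => (1 + y) `^ c) x 1.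
  by move=> /D_gt0[_ /is_derive_powR_onep-/(_ c)[]].
have mg : measurable_fun D g.
  apply: measurable_funTS; apply: measurable_funD.
    by apply: (measurableT_comp (measurable_powR _)); exact: measurable_funB.
  by apply: (measurableT_comp (measurable_powR _)); exact: measurable_funD.
have g0 x : 0 <= g x by rewrite addr_ge0// powR_ge0.
have ig : mu.-integrable D (EFin \o g).
  apply: (@integrable_oo_bounded_primitive _ G g
    ((b + 1)^-1 * 2 `^ (b + 1) + (a + 1)^-1 * 2 `^ (a + 1))) => //.
  - move=> x /D_gt0[x1 x2].
    have hl := is_derive_powR_onem (a + 1) x1.
    have hr := is_derive_powR_onep (b + 1) x2.
    change (is_derive x 1 ((b + 1)^-1 *: (fun y : R => (1 + y) `^ (b + 1)) -
      (a + 1)^-1 *: (fun y : R => (1 - y) `^ (a + 1))) (g x)).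
    apply: is_derive_eq.
    by rewrite !addrK /GRing.scale/= mulrN opprK !mulKf ?gt_eqF// addrC.
  - by move=> x Dx; apply: derivableD; [exact: dl|exact: dr].
  - move=> x Dx; have [x1 x2] := D_gt0 Dx.
    have A := powR_ge0 (1 - x) (a + 1); have B := powR_ge0 (1 + x) (b + 1).
    have C : (1 - x) `^ (a + 1) <= 2 `^ (a + 1) by apply: powR_le2; lra.
    have C' : (1 + x) `^ (b + 1) <= 2 `^ (b + 1) by apply: powR_le2; lra.
    have ia : 0 <= (a + 1)^-1 by rewrite invr_ge0 ltW.
    have ib : 0 <= (b + 1)^-1 by rewrite invr_ge0 ltW.
    have P1 := mulr_ge0 ia A; have P2 := mulr_ge0 ib B.
    have P3 := ler_wpM2l ia C; have P4 := ler_wpM2l ib C'.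
    by rewrite /G ler_norml; apply/andP; split; lra.
pose K : R := 2 `^ `|a| + 2 `^ `|b|.
have mw : measurable_fun D (fun x => (jacobi_weight a b x)%:E).
  by apply/measurable_EFinP/measurable_funTS; exact: measurable_jacobi_weight.
apply: (@le_integrable _ _ _ mu D _ _ (fun x => (K * g x)%:E)) => //;
  last first.
  exact: (integrableZl _ K ig).
move=> x Dx.
rewrite /= lee_fin !ger0_norm ?jacobi_weight_ge0//.
  exact: jacobi_weight_le.
by rewrite mulr_ge0// addr_ge0// powR_ge0.
Qed.

Lemma horner_bounded_oo p : exists K, forall x, D x -> `|p.[x]| <= K.
Proof.
elim/poly_ind: p => [|p c [K pK]].
  by exists 0 => x _; rewrite horner0 normr0.
exists (K + `|c|) => x Dx; rewrite hornerMXaddC.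
apply: (le_trans (ler_normD _ _)); rewrite lerD2r normrM.
have x1 : `|x| <= 1.
  by have [? ?] := D_gt0 Dx; rewrite ler_norml; apply/andP; split; lra.
apply: le_trans (pK x Dx).
by rewrite -[leRHS]mulr1 ler_wpM2l.
Qed.

Lemma integrable_poly_jacobi_weight a b p : -1 < a -> -1 < b ->
  mu.-integrable D (fun x => (p.[x] * jacobi_weight a b x)%:E).
Proof.
move=> a1 b1; have iw := integrable_jacobi_weight a1 b1.
have [K pK] := horner_bounded_oo p.
have mpw : measurable_fun D (fun x => (p.[x] * jacobi_weight a b x)%:E).
  apply/measurable_EFinP/measurable_funM; first exact: measurable_poly.
  by apply: measurable_funTS; exact: measurable_jacobi_weight.
apply: (@le_integrable _ _ _ mu D _ _
    (fun x => (K * jacobi_weight a b x)%:E)) => //; last first.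
  exact: (integrableZl _ K iw).
move=> x Dx.
rewrite /= lee_fin !normrM ler_wpM2r//.
by apply: (le_trans (pK x Dx)); exact: ler_norm.
Qed.

Definition jacobi_functional a b p : R :=
  \int[mu]_(x in D) (p.[x] * jacobi_weight a b x).

Local Notation L := jacobi_functional.

Lemma jacobi_functionalD a b p q : -1 < a -> -1 < b ->
  L a b (p + q) = L a b p + L a b q.
Proof.
move=> a1 b1; rewrite /jacobi_functional -RintegralD//; last 2 first.
- exact: (integrable_poly_jacobi_weight p a1 b1).
- exact: (integrable_poly_jacobi_weight q a1 b1).
by apply: eq_Rintegral => x _; rewrite hornerD mulrDl.
Qed.

Lemma jacobi_functionalZ a b c p : -1 < a -> -1 < b ->
  L a b (c *: p) = c * L a b p.
Proof.
move=> a1 b1; rewrite /jacobi_functional -(@RintegralZl _ _ _ mu D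
  (fun x => p.[x] * jacobi_weight a b x))//; last first.
  exact: (integrable_poly_jacobi_weight p a1 b1).
by apply: eq_Rintegral => x _; rewrite hornerZ -mulrA.
Qed.

Lemma jacobi_functionalSl a b p : L (a + 1) b p = L a b ((1 - 'X) * p).
Proof.
apply: eq_Rintegral => x /[!inE] Dx; rewrite jacobi_weightSl// hornerM.
have -> : (1 - 'X : {poly R}).[x] = 1 - x by rewrite !hornerE.
ring.
Qed.

Lemma jacobi_functionalSr a b p : L a (b + 1) p = L a b ((1 + 'X) * p).
Proof.
apply: eq_Rintegral => x /[!inE] Dx; rewrite jacobi_weightSr// hornerM.
have -> : (1 + 'X : {poly R}).[x] = 1 + x by rewrite !hornerE.
ring.
Qed.

Lemma jacobi_functional1_gt0 a b : -1 < a -> -1 < b -> 0 < L a b 1.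
Proof.
move=> a1 b1; have iw := integrable_jacobi_weight a1 b1.
have L1 : (L a b 1)%:E = (\int[mu]_(x in D) (jacobi_weight a b x)%:E)%E.
  rewrite /jacobi_functional /Rintegral.
  under eq_integral do rewrite hornerC mul1r.
  by rewrite fineK//; exact: integrable_fin_num.
rewrite lt_neqAle -!lee_fin; apply/andP; split; last first.
  by rewrite L1; apply: integral_ge0 => x _; rewrite lee_fin jacobi_weight_ge0.
apply/eqP => L0.
have : (\int[mu]_(x in D) `|(jacobi_weight a b x)%:E| = 0)%E.
  rewrite -[RHS]/(0%:E) L0 L1; apply: eq_integral => x _.
  by rewrite /= ger0_norm// jacobi_weight_ge0.
have mw := measurable_int _ iw.
have aeP := ae_eq_integral_abs mu _ mw.
case/aeP => // N [mN N0 sub].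
(* A zero integral would make the positive weight vanish almost everywhere,
   but the interval has measure 2. *)
suff : (mu D <= mu N)%E.
  by rewrite N0 lebesgue_measure_itv/= lte_fin ifT;
    [rewrite -EFinB lee_fin|]; lra.
apply: le_measure; rewrite ?inE//; apply: subset_trans sub => x Dx /=.
by move=> /(_ Dx) [] /eqP; rewrite gt_eqF// jacobi_weight_gt0.
Qed.

Lemma cvg_powR_onem a : 0 < a -> (1 - x) `^ a @[x --> 1^'-] --> (0 : R).
Proof.
move=> /powR_cvg0/cvg_at_rightP a0; apply/cvg_at_leftP => u [u1 ucvg].
apply: (a0 (fun n => 1 - u n)); split; first by move=> n; rewrite subr_gt0.
by rewrite -[X in _ --> X](subrr 1); apply: cvgB => //; exact: cvg_cst.
Qed.

Lemma cvg_powR_onep a : 0 < a -> (1 + x) `^ a @[x --> (-1)^'+] --> (0 : R).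
Proof.
move=> /powR_cvg0/cvg_at_rightP a0; apply/cvg_at_rightP => u [u1 ucvg].
apply: (a0 (fun n => 1 + u n)); split.
  by move=> n; have := u1 n; lra.
by rewrite -[X in _ --> X](subrr 1); apply: cvgD => //; exact: cvg_cst.
Qed.

(** The Pearson identity: the argument times the weight is the derivative of a
    function which vanishes at both end points, because a + 1 and b + 1 are
    positive. *)
Lemma jacobi_functional_raise a b q : -1 < a -> -1 < b ->
  L a b (jacobi_raise a b q) = 0.
Proof.
move=> a1 b1; have a0 : 0 < a + 1 by lra. have b0 : 0 < b + 1 by lra.
suff E : (\int[mu]_(x in D)
    ((jacobi_raise a b q).[x] * jacobi_weight a b x)%:E =
    0%:E - 0%:E)%E by rewrite /jacobi_functional /Rintegral E subee.
apply: (@integral_oo_FTC _ (fun y => q.[y] * jacobi_weight (a + 1) (b + 1) y)).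
- exact: integrable_poly_jacobi_weight.
- by move=> x Dx; exact: is_derive_jacobi_raise.
- by move=> x Dx; exact: derivable_jacobi_weight.
- have hc : {for -1, continuous (fun x : R => (1 - x) `^ (a + 1))}.
    apply/differentiable_continuous/derivable1_diffP.
    by have [] := @is_derive_powR_onem (a + 1) (-1); first lra.
  have -> : 0 = q.[-1] * ((1 - -1) `^ (a + 1) * 0) :> R by rewrite !mulr0.
  apply: cvgM; first exact/cvg_at_right_filter/continuous_horner.
  by apply: cvgM; [exact/cvg_at_right_filter/hc|exact: cvg_powR_onep].
- have hc : {for 1, continuous (fun x : R => (1 + x) `^ (b + 1))}.
    apply/differentiable_continuous/derivable1_diffP.
    by have [] := @is_derive_powR_onep (b + 1) 1; first lra.
  have -> : 0 = q.[1] * (0 * (1 + 1) `^ (b + 1)) :> R by rewrite mul0r !mulr0.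
  apply: cvgM; first exact/cvg_at_left_filter/continuous_horner.
  by apply: cvgM; [exact: cvg_powR_onem|exact/cvg_at_left_filter/hc].
Qed.


End jacobi_functional.

(** * Jacobi polynomials by the formula of Rodrigues *)

Section jacobi_polynomials.
Context (R : realType).
Implicit Types (a b : R) (p q : {poly R}).
Local Notation L := (@jacobi_functional R).

(** The formula of Rodrigues, one derivative at a time: each step lowers both
    parameters by one, and the scalar is the inverse of the leading coefficient
    of the raised polynomial. *)
Fixpoint jacobi_poly a b n : {poly R} :=
  if n is m.+1 then
    - (m%:R + a + b + 2)^-1 *: jacobi_raise a b (jacobi_poly (a + 1) (b + 1) m)
  else 1.

Lemma jacobi_polyS a b m : jacobi_poly a b m.+1 =
  - (m%:R + a + b + 2)^-1 *: jacobi_raise a b (jacobi_poly (a + 1) (b + 1) m).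
Proof. by []. Qed.

Lemma jacobi_functionalB a b p q : -1 < a -> -1 < b ->
  L a b (p - q) = L a b p - L a b q.
Proof.
move=> a1 b1.
by rewrite -scaleN1r jacobi_functionalD// jacobi_functionalZ// mulN1r.
Qed.

(** The Pearson identity for the product p q. *)
Lemma jacobi_functional_by_parts a b p q : -1 < a -> -1 < b ->
  L a b (jacobi_raise a b p * q) = - L (a + 1) (b + 1) (p * q^`()).
Proof.
move=> a1 b1; rewrite jacobi_functionalSl jacobi_functionalSr.
apply/eqP; rewrite -addr_eq0 -jacobi_functionalD//.
rewrite -[X in _ == X](jacobi_functional_raise (p * q) a1 b1).
apply/eqP; congr (L a b _); rewrite /jacobi_raise derivM; ring.
Qed.

Lemma coef0_jacobi_raise a b q :
  (jacobi_raise a b q)`_0 = q`_1 + (b - a) * q`_0.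
Proof.
rewrite /jacobi_raise coefD !mulrBl mul1r !coefB -scalerAl coefZ.
by rewrite coefXnM coefXM coefCM/= coef_deriv mulr0 !subr0 mulr1n mulrBl.
Qed.

Lemma coefS_jacobi_raise a b q m :
  (jacobi_raise a b q)`_m.+1 = q`_m.+2 *+ m.+2 + (b - a) * q`_m.+1
    - (m%:R + a + b + 2) * q`_m.
Proof.
rewrite /jacobi_raise coefD !mulrBl mul1r !coefB -scalerAl coefZ.
rewrite coefXnM coefXM coefCM/= !coef_deriv.
case: m => [|m] /=; first by ring.
rewrite subSS subn1/=; ring.
Qed.

Let den_neq0 a b m : -1 < a -> -1 < b -> m%:R + a + b + 2 != 0.
Proof. by move=> a1 b1; have m0 := ler0n R m; rewrite gt_eqF//; lra. Qed.

Lemma size_jacobi_raise_le a b q n :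
  (size q <= n)%N -> (size (jacobi_raise a b q) <= n.+1)%N.
Proof.
move=> sq; apply/leq_sizeP => -[|m]// nm.
have sm : (size q <= m)%N := leq_trans sq nm.
rewrite coefS_jacobi_raise (nth_default _ sm) (nth_default _ (leqW sm)).
by rewrite (nth_default _ (leqW (leqW sm))) mul0rn !mulr0 addr0 subr0.
Qed.

Lemma jacobi_poly_size_le_coefn a b n : -1 < a -> -1 < b ->
  (size (jacobi_poly a b n) <= n.+1)%N /\ (jacobi_poly a b n)`_n = 1.
Proof.
elim: n a b => [|n IHn] a b a1 b1 /=; first by rewrite size_poly1 coefC.
have [sz lc] : (size (jacobi_poly (a + 1) (b + 1) n) <= n.+1)%N /\
    (jacobi_poly (a + 1) (b + 1) n)`_n = 1 by apply: IHn; lra.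
split.
  by apply: leq_trans (size_scale_leq _ _) _; exact: size_jacobi_raise_le.
rewrite coefZ coefS_jacobi_raise lc !(nth_default _ _)//; last first.
  by apply: leq_trans sz _.
rewrite mul0rn mulr0 add0r sub0r mulr1 mulrNN mulVf//.
exact: den_neq0.
Qed.

(** Coefficient of x^(n-1) in the monic Jacobi polynomial of degree n. *)
Definition jacobi_coef1 a b (n : nat) : R :=
  n%:R * (a - b) / (2 * n%:R + a + b).

(** Coefficient of x^(n-2) in the monic Jacobi polynomial of degree n; it
    vanishes for n = 1 even if the denominator does. *)
Definition jacobi_coef2 a b (n : nat) : R :=
  n%:R * (n%:R - 1) * ((a - b) ^+ 2 - (2 * n%:R + a + b)) /
  (2 * (2 * n%:R + a + b) * (2 * n%:R + a + b - 1)).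

Lemma jacobi_poly_coef1 a b n : -1 < a -> -1 < b ->
  (jacobi_poly a b n.+1)`_n = jacobi_coef1 a b n.+1.
Proof.
elim: n a b => [|n IHn] a b a1 b1.
  rewrite /= coefZ coef0_jacobi_raise !coefC/= /jacobi_coef1.
  by field; apply/eqP; lra.
have a1' : -1 < a + 1 by lra. have b1' : -1 < b + 1 by lra.
have [sz lc] := jacobi_poly_size_le_coefn n.+1 a1' b1'.
rewrite jacobi_polyS coefZ coefS_jacobi_raise lc IHn//.
rewrite (nth_default _ sz) mul0rn add0r.
rewrite /jacobi_coef1 -!natr1.
have := ler0n R n.
set x := n%:R => x0; field.
by apply/andP; split; apply/eqP; lra.
Qed.

Lemma jacobi_poly_coef2 a b n : -1 < a -> -1 < b ->
  (jacobi_poly a b n.+2)`_n = jacobi_coef2 a b n.+2.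
Proof.
elim: n a b => [|n IHn] a b a1 b1;
  have a1' : -1 < a + 1 by lra.
all: have b1' : -1 < b + 1 by lra.
  have [sz lc] := jacobi_poly_size_le_coefn 1 a1' b1'.
  rewrite jacobi_polyS coefZ coef0_jacobi_raise lc jacobi_poly_coef1//.
  rewrite /jacobi_coef2 /jacobi_coef1.
  field.
  by rewrite ?andbT; repeat (apply/andP; split); apply/eqP; lra.
have [sz lc] := jacobi_poly_size_le_coefn n.+2 a1' b1'.
rewrite jacobi_polyS coefZ coefS_jacobi_raise lc IHn// jacobi_poly_coef1//.
rewrite /jacobi_coef1 /jacobi_coef2 -mulr_natl -!natr1.
have := ler0n R n.
set x := n%:R => x0; field.
by rewrite ?andbT; repeat (apply/andP; split); apply/eqP; lra.
Qed.

(** Each integration by parts lowers the degree of both factors, until the test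
    polynomial has been differentiated away. *)
Lemma jacobi_poly_orth a b n q : -1 < a -> -1 < b -> (size q <= n)%N ->
  L a b (jacobi_poly a b n * q) = 0.
Proof.
elim: n a b q => [|n IHn] a b q a1 b1 sq.
  move: sq; rewrite leqn0 size_poly_eq0 => /eqP ->.
  by rewrite mulr0 -(scale0r 0) jacobi_functionalZ// mul0r.
rewrite /= -scalerAl jacobi_functionalZ// jacobi_functional_by_parts//.
rewrite IHn ?oppr0 ?mulr0//; try lra.
apply/leq_sizeP => j nj; rewrite coef_deriv nth_default ?mul0rn//.
exact: leq_trans sq _.
Qed.

(** The n-th derivative of x^n is a positive constant, so n integrations by
    parts reduce the claim to the positivity of the functional at 1. *)
Lemma jacobi_poly_norm_gt0 a b n : -1 < a -> -1 < b ->
  0 < L a b (jacobi_poly a b n * 'X^n).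
Proof.
elim: n a b => [|n IHn] a b a1 b1.
  by rewrite expr0 mulr1; exact: jacobi_functional1_gt0.
rewrite /= -scalerAl jacobi_functionalZ// jacobi_functional_by_parts//.
rewrite derivXn mulrnAr -(scaler_nat _ (_ * _)) jacobi_functionalZ; try lra.
rewrite mulrNN mulr_gt0//; last by rewrite mulr_gt0// IHn//; lra.
by rewrite invr_gt0; have := ler0n R n; lra.
Qed.

Lemma jacobi_poly_lead a b n q : -1 < a -> -1 < b -> (size q <= n.+1)%N ->
  L a b (jacobi_poly a b n * q) = q`_n * L a b (jacobi_poly a b n * 'X^n).
Proof.
move=> a1 b1 sq; rewrite -{1}(subrK (q`_n *: 'X^n) q) mulrDr.
rewrite jacobi_functionalD// jacobi_poly_orth ?add0r//.
  by rewrite -scalerAr jacobi_functionalZ.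
apply/leq_sizeP => j nj; rewrite coefB coefZ coefXn.
have [->|jn] := eqVneq j n; first by rewrite mulr1 subrr.
by rewrite mulr0 subr0 nth_default//; apply: leq_trans sq _; lia.
Qed.

(** If the difference of the two sides had degree m < n, pairing it with the
    m-th polynomial would give its leading coefficient times a positive norm,
    although it is orthogonal to all degrees below n. *)
Lemma jacobi_poly_unique a b n p : -1 < a -> -1 < b -> (size p <= n.+1)%N ->
  (forall q, (size q <= n)%N -> L a b (p * q) = 0) ->
  p = p`_n *: jacobi_poly a b n.
Proof.
move=> a1 b1 sp orth; apply/eqP; rewrite -subr_eq0; apply/negPn/negP => d0.
set d := p - _ in d0.
have [sJ lJ] := jacobi_poly_size_le_coefn n a1 b1.
have sd : (size d <= n)%N.
  apply/leq_sizeP => j; rewrite leq_eqVlt => /predU1P[<-|nj].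
    by rewrite coefB coefZ lJ mulr1 subrr.
  rewrite coefB coefZ (nth_default _ (leq_trans sp nj)).
  by rewrite (nth_default _ (leq_trans sJ nj)) mulr0 subrr.
have dorth q : (size q <= n)%N -> L a b (d * q) = 0.
  move=> sq; rewrite mulrBl jacobi_functionalB// orth// -scalerAl.
  by rewrite jacobi_functionalZ// jacobi_poly_orth// mulr0 subrr.
have [m sdm] : exists m, size d = m.+1.
  by exists (size d).-1; rewrite prednK// size_poly_gt0.
have [sJm _] := jacobi_poly_size_le_coefn m a1 b1.
have /dorth/eqP : (size (jacobi_poly a b m) <= n)%N.
  by apply: leq_trans sJm _; rewrite -sdm.
rewrite mulrC jacobi_poly_lead ?sdm// mulf_eq0.
rewrite (gt_eqF (jacobi_poly_norm_gt0 _ _ _))// orbF.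
by rewrite -[m]/(m.+1.-1) -sdm -lead_coefE lead_coef_eq0 (negPf d0).
Qed.

End jacobi_polynomials.

(** * Identification with the monic orthogonal sequence *)

Section jacobi_identification.
Context (R : realType).
Implicit Types (a b : R) (p q : {poly R}).
Local Notation L := (@jacobi_functional R).

Lemma integral_jacobi_horner a b p : -1 < a -> -1 < b ->
  (\int[jacobi_measure a b]_x (p.[x])%:E = (L a b p)%:E)%E.
Proof.
move=> a1 b1; rewrite integral_jacobi; last exact: measurable_poly.
rewrite /jacobi_functional /Rintegral fineK//.
by apply: integrable_fin_num => //; exact: integrable_poly_jacobi_weight.
Qed.

Lemma integral_jacobi_hornerM a b p q : -1 < a -> -1 < b ->
  (\int[jacobi_measure a b]_x (p.[x] * q.[x])%:E = (L a b (p * q))%:E)%E.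
Proof.
move=> a1 b1; rewrite -integral_jacobi_horner//.
by apply: eq_integral => x _; rewrite hornerM.
Qed.

Lemma jacobi_poly_monic a b n : -1 < a -> -1 < b ->
  jacobi_poly a b n \is monic /\ size (jacobi_poly a b n) = n.+1.
Proof.
move=> a1 b1; have [sz lc] := jacobi_poly_size_le_coefn n a1 b1.
have szE : size (jacobi_poly a b n) = n.+1.
  apply/eqP; rewrite eqn_leq sz ltnNge; apply/negP => /(nth_default 0).
  by rewrite lc => /eqP; rewrite oner_eq0.
by split=> //; rewrite monicE lead_coefE szE lc.
Qed.

Lemma jacobi_functional_square_gt0 a b n : -1 < a -> -1 < b ->
  0 < L a b (jacobi_poly a b n * jacobi_poly a b n).
Proof.
move=> a1 b1; have [sz lc] := jacobi_poly_size_le_coefn n a1 b1.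
by rewrite jacobi_poly_lead// lc mul1r jacobi_poly_norm_gt0.
Qed.

Lemma jacobi_functional_orth a b n m : -1 < a -> -1 < b -> n <> m ->
  L a b (jacobi_poly a b n * jacobi_poly a b m) = 0.
Proof.
move=> a1 b1 /eqP; rewrite neq_ltn => /orP[nm|mn].
  by rewrite mulrC jacobi_poly_orth//; have [_ ->] := jacobi_poly_monic n a1 b1.
by rewrite jacobi_poly_orth//; have [_ ->] := jacobi_poly_monic m a1 b1.
Qed.

Lemma is_monic_jacobi_poly a b : -1 < a -> -1 < b ->
  is_monic_jacobi a b (jacobi_poly a b).
Proof.
move=> a1 b1; split => [n|n m _ _]; first exact: jacobi_poly_monic.
split.
- apply: integrable_jacobi.
    by apply: measurable_funM; exact: measurable_poly.
  have := integrable_poly_jacobi_weight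
    (jacobi_poly a b n * jacobi_poly a b m) a1 b1.
  by apply: eq_integrable => // x _; rewrite hornerM.
- by move=> nm; rewrite integral_jacobi_hornerM// jacobi_functional_orth.
- move=> <-; rewrite integral_jacobi_hornerM// => -[] /eqP.
  by rewrite gt_eqF// jacobi_functional_square_gt0.
Qed.

(** Any monic orthogonal sequence spans, degree by degree, all polynomials, so
    its n-th term is orthogonal to every smaller degree. *)
Lemma is_monic_jacobi_unique a b P : -1 < a -> -1 < b ->
  is_monic_jacobi a b P -> P = jacobi_poly a b.
Proof.
move=> a1 b1 [monP orthP]; apply/funext => n.
have lcP k : (P k)`_k = 1.
  by have [/monicP + szP] := monP k; rewrite lead_coefE szP.
have Lorth q : (size q <= n)%N -> L a b (P n * q) = 0.
  suff : forall k, (k <= n)%N -> (size q <= k)%N -> L a b (P n * q) = 0.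
    by move=> /(_ n (leqnn n)).
  move=> k; elim: k q => [|k IHk] q kn sq.
    move: sq; rewrite leqn0 size_poly_eq0 => /eqP ->.
    by rewrite mulr0 -(scale0r 0) jacobi_functionalZ// mul0r.
  rewrite -[q](subrK (q`_k *: P k)) mulrDr jacobi_functionalD//.
  rewrite IHk ?(ltnW kn)// ?add0r; last first.
    apply/leq_sizeP => j; rewrite leq_eqVlt => /predU1P[<-|kj].
      by rewrite coefB coefZ lcP mulr1 subrr.
    rewrite coefB coefZ (nth_default _ (leq_trans sq kj)) sub0r.
    rewrite [(P k)`_j]nth_default ?mulr0 ?oppr0//.
    by have [_ szP] := monP k; rewrite szP.
  rewrite -scalerAr jacobi_functionalZ//.
  have [_ /(_ _)] := orthP n k isT isT.
  rewrite integral_jacobi_hornerM// => Lnk _.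
  have [] : (L a b (P n * P k))%:E = 0%:E :> \bar R.
    by apply: Lnk; move=> nk; rewrite nk ltnn in kn.
  by move=> ->; rewrite mulr0.
have [_ szP] := monP n.
by rewrite [LHS](@jacobi_poly_unique _ a b n) ?szP// lcP scale1r.
Qed.

Lemma jacobiE a b : -1 < a -> -1 < b -> jacobi a b = jacobi_poly a b.
Proof.
move=> a1 b1; apply: is_monic_jacobi_unique => //; rewrite /jacobi.
by apply: (xgetPex (fun=> 0)); exists (jacobi_poly a b);
  exact: is_monic_jacobi_poly.
Qed.

(** Multiplying by x makes the coefficient of x^(n-1) accessible for n = 0 too,
    where it is 0. *)
Lemma coef1_mulX_jacobi_poly a b n : -1 < a -> -1 < b ->
  ('X * jacobi_poly a b n)`_n = jacobi_coef1 a b n.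
Proof.
move=> a1 b1; rewrite coefXM; case: n => [|n] /=.
  by rewrite /jacobi_coef1 !mul0r.
by rewrite jacobi_poly_coef1.
Qed.

Lemma coef2_mulX_jacobi_poly a b n : -1 < a -> -1 < b ->
  ('X * jacobi_poly a b n.+1)`_n = jacobi_coef2 a b n.+1.
Proof.
move=> a1 b1; rewrite coefXM; case: n => [|n] /=.
  by rewrite /jacobi_coef2 subrr mulr0 !mul0r.
by rewrite jacobi_poly_coef2.
Qed.

(** The factor x - 1 turns the functional for (a,b) into minus the one for
    (a+1,b), so the left side is orthogonal to all degrees below n.  The scalar
    is the difference of the coefficients of x^n. *)
Lemma christoffel_jacobi_poly a b n : -1 < a -> -1 < b ->
  ('X - 1) * jacobi_poly (a + 1) b n =
  jacobi_poly a b n.+1 +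
  (jacobi_coef1 (a + 1) b n - 1 - jacobi_coef1 a b n.+1) *: jacobi_poly a b n.
Proof.
move=> a1 b1; have a1' : -1 < a + 1 by lra.
have [sz lc] := jacobi_poly_size_le_coefn n a1' b1.
have [sz1 lc1] := jacobi_poly_size_le_coefn n.+1 a1 b1.
set p := ('X - 1) * _.
have pE k : p`_k =
    ('X * jacobi_poly (a + 1) b n)`_k - (jacobi_poly (a + 1) b n)`_k.
  by rewrite /p mulrBl mul1r coefB.
apply/eqP; rewrite -subr_eq0 opprD addrA subr_eq0; apply/eqP.
rewrite [LHS](@jacobi_poly_unique _ a b n) //.
- congr (_ *: _); rewrite coefB pE coef1_mulX_jacobi_poly// lc.
  by rewrite jacobi_poly_coef1.
- apply/leq_sizeP => -[//|j]; rewrite ltnS leq_eqVlt => /predU1P[<-|nj].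
    rewrite coefB pE lc1 coefXM/= lc (nth_default _ sz) subr0 subrr//.
  rewrite coefB pE coefXM/= (nth_default _ (leq_trans sz nj)).
  rewrite (nth_default _ (leq_trans sz (leqW nj))).
  by rewrite (nth_default _ (leq_trans sz1 _))// !subrr.
- move=> q sq; rewrite mulrBl jacobi_functionalB//.
  rewrite (jacobi_poly_orth a1 b1 (leqW sq)) subr0.
  have -> : p * q = - 1 *: ((1 - 'X) * (jacobi_poly (a + 1) b n * q)).
    by rewrite scaleN1r /p; ring.
  by rewrite jacobi_functionalZ// -jacobi_functionalSl jacobi_poly_orth// mulr0.
Qed.

(** The first parameter cancels the coefficient of x^(n+1) in
    (x - c) P_(n+1) - P_(n+2), which is orthogonal to all degrees below n; the
    second one is what remains as coefficient of x^n. *)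
Lemma jacobi_poly_recurrence a b n : -1 < a -> -1 < b ->
  jacobi_poly a b n.+2 =
  ('X - (jacobi_coef1 a b n.+1 - jacobi_coef1 a b n.+2)%:P) *
    jacobi_poly a b n.+1 -
  (jacobi_coef2 a b n.+1 - jacobi_coef2 a b n.+2 -
   (jacobi_coef1 a b n.+1 - jacobi_coef1 a b n.+2) * jacobi_coef1 a b n.+1) *:
   jacobi_poly a b n.
Proof.
move=> a1 b1.
have [sz0 lc0] := jacobi_poly_size_le_coefn n a1 b1.
have [sz1 lc1] := jacobi_poly_size_le_coefn n.+1 a1 b1.
have [sz2 lc2] := jacobi_poly_size_le_coefn n.+2 a1 b1.
set c := jacobi_coef1 a b n.+1 - _.
set p := ('X - _) * _.
have pE k : p`_k =
    ('X * jacobi_poly a b n.+1)`_k - c * (jacobi_poly a b n.+1)`_k.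
  by rewrite /p mulrBl coefB coefCM.
apply: (can_inj (subKr p)); rewrite subKr.
rewrite [LHS](@jacobi_poly_unique _ a b n) //.
- congr (_ *: _); rewrite coefB pE coef2_mulX_jacobi_poly// jacobi_poly_coef1//.
  by rewrite jacobi_poly_coef2// addrAC.
- apply/leq_sizeP => -[//|j]; rewrite ltnS => nj; rewrite coefB pE coefXM/=.
  move: nj; rewrite leq_eqVlt => /predU1P[<-|].
    by rewrite jacobi_poly_coef1// lc1 jacobi_poly_coef1// mulr1 /c; ring.
  rewrite leq_eqVlt => /predU1P[<-|nj].
    by rewrite lc1 lc2 (nth_default _ sz1) mulr0 subr0 subrr.
  rewrite (nth_default _ (leq_trans sz1 nj)).
  rewrite (nth_default _ (leq_trans sz1 (leqW nj))).
  by rewrite (nth_default _ (leq_trans sz2 _))// mulr0 !subrr.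
- move=> q sq; rewrite mulrBl jacobi_functionalB//.
  rewrite (jacobi_poly_orth (n := n.+2) a1 b1 (leqW (leqW sq))) subr0.
  have -> : p * q = jacobi_poly a b n.+1 * (('X - c%:P) * q).
    by rewrite /p; ring.
  rewrite jacobi_poly_orth//; apply: leq_trans (size_polyMleq _ _) _.
  by rewrite size_XsubC.
Qed.

End jacobi_identification.

(** * Quasi-Christoffel polynomials *)

(** Identifies gamma as the scalar of the connection formula for the parameters
    (alpha, beta+1). *)
Lemma gamma_jacobi_coef1 (R : realType) (alpha beta : R) n :
  -1 < alpha -> -1 < beta ->
  jacobi_coef1 (alpha + 1) (beta + 1) n - 1
    - jacobi_coef1 alpha (beta + 1) n.+1 =
  gamma_ alpha beta n.+1.
Proof.
move=> a1 b1; rewrite /jacobi_coef1 /gamma_ -natr1.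
have := ler0n R n; set x := n%:R => x0; field.
by repeat (apply/andP; split); apply/eqP; lra.
Qed.

Lemma J_qcE (R : realType) (alpha beta : R) n : -1 < alpha -> -1 < beta ->
  J_qc alpha beta n.+1 = ('X - 1%:P) * jacobi_poly (alpha + 1) (beta + 1) n.
Proof.
move=> a1 b1; have b1' : -1 < beta + 1 by lra.
rewrite /J_qc jacobiE// [RHS]christoffel_jacobi_poly//.
by rewrite gamma_jacobi_coef1.
Qed.

Lemma gamma_difference_equation (R : realType) (alpha beta : R) n :
  -1 < alpha -> -1 < beta -> (2 <= n)%N ->
  c_c alpha beta n.+1 - c_c alpha beta n
  + gamma_ alpha beta n - gamma_ alpha beta n.+1
  - lambda_c alpha beta n.+1 / gamma_ alpha beta n
  + lambda_c alpha beta n / gamma_ alpha beta n.-1 = 0.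
Proof.
move=> a1 b1; case: n => [|[|n]]// _.
rewrite /c_c /gamma_ /lambda_c [n.+2.-1]/= -!natr1.
have := ler0n R n; set x := n%:R => x0; field.
by repeat (apply/andP; split); apply/eqP; lra.
Qed.

(** Identifies the parameters of the theorem with those of the recurrence for
    (alpha+1, beta+1); the index is shifted because of the factor x - 1. *)
Lemma qc_coefficients (R : realType) (alpha beta : R) n :
  -1 < alpha -> -1 < beta ->
  let a := alpha + 1 in let b := beta + 1 in
  let c := jacobi_coef1 a b n.+1 - jacobi_coef1 a b n.+2 in
  c = c_qc alpha beta n.+3 /\
  jacobi_coef2 a b n.+1 - jacobi_coef2 a b n.+2 - c * jacobi_coef1 a b n.+1 =
    lambda_qc alpha beta n.+3.
Proof.
move=> a1 b1 /=; rewrite /jacobi_coef1 /jacobi_coef2 /c_qc /lambda_qc -!natr1.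
have := ler0n R n; set x := n%:R => x0; split; field.
  by repeat (apply/andP; split); apply/eqP; lra.
by repeat (apply/andP; split); apply/eqP; lra.
Qed.

Theorem mainTheorem1 (R : realType) (alpha beta : R)
    (halpha : -1 < alpha) (hbeta : -1 < beta) :
  [/\ (forall n : nat, (2 <= n)%N ->
         c_c alpha beta n.+1 - c_c alpha beta n
         + gamma_ alpha beta n - gamma_ alpha beta n.+1
         - lambda_c alpha beta n.+1 / gamma_ alpha beta n
         + lambda_c alpha beta n / gamma_ alpha beta n.-1 = 0),
      (forall n : nat, (1 <= n)%N ->
         J_qc alpha beta n
         = ('X - 1%:P) * jacobi (alpha + 1) (beta + 1) n.-1),
      (forall n : nat, (2 <= n)%N ->
         J_qc alpha beta n.+1
         = ('X - (c_qc alpha beta n.+1)%:P) * J_qc alpha beta n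
           - lambda_qc alpha beta n.+1 *: J_qc alpha beta n.-1) &
      orthogonal_family (jacobi_measure (alpha - 1) (beta + 1)) 1
        (J_qc alpha beta)].
Proof.
have a1 : -1 < alpha + 1 by lra.
have b1 : -1 < beta + 1 by lra.
split.
- by move=> n n2; exact: gamma_difference_equation.
- by move=> [//|n] _; rewrite J_qcE// jacobiE.
- move=> [//|[//|n]] _; rewrite !J_qcE// jacobi_poly_recurrence//.
  have [-> ->] := qc_coefficients n halpha hbeta.
  by rewrite mulrBr mulrCA scalerAr.
- move=> [//|n] [//|m] _ _.
  pose pn := jacobi_poly (alpha + 1) (beta + 1) n.
  pose pm := jacobi_poly (alpha + 1) (beta + 1) m.
  have mJJ : measurable_fun [set: measurableTypeR R]
      (fun x => (J_qc alpha beta n.+1).[x] * (J_qc alpha beta m.+1).[x]).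
    by apply: measurable_funM; exact: measurable_poly.
  have mpp : measurable_fun [set: measurableTypeR R] (horner (pn * pm)).
    exact: measurable_poly.
  have wE x : x \in (`](-1)%R, 1%R[%classic : set R) ->
      (J_qc alpha beta n.+1).[x] * (J_qc alpha beta m.+1).[x] *
        jacobi_weight (alpha - 1) (beta + 1) x =
      (pn * pm).[x] * jacobi_weight (alpha + 1) (beta + 1) x.
    rewrite inE => Dx.
    (* Two steps alpha - 1, alpha, alpha + 1, each absorbing a factor 1 - x. *)
    have -> : alpha + 1 = alpha - 1 + 1 + 1 by rewrite subrK.
    rewrite !(@jacobi_weightSl _ _ _ _ Dx) !J_qcE// !hornerM !hornerXsubC.
    by rewrite -/pn -/pm; ring.
  have JL : (\int[jacobi_measure (alpha - 1) (beta + 1)]_x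
      ((J_qc alpha beta n.+1).[x] * (J_qc alpha beta m.+1).[x])%:E)%E =
      (jacobi_functional (alpha + 1) (beta + 1) (pn * pm))%:E.
    apply: etrans (integral_jacobi_horner (pn * pm) a1 b1).
    rewrite (integral_jacobi (alpha - 1) (beta + 1) mJJ).
    rewrite (integral_jacobi (alpha + 1) (beta + 1) mpp).
    by apply: eq_integral => x Dx; rewrite wE.
  split.
  + apply: (integrable_jacobi mJJ).
    have := integrable_poly_jacobi_weight (pn * pm) a1 b1.
    by apply: eq_integrable => // x Dx; rewrite wE.
  + move=> nm; rewrite JL jacobi_functional_orth// => nm'.
    by apply: nm; rewrite nm'.
  + move=> [nm]; rewrite JL /pm -nm => -[] /eqP.
    by rewrite gt_eqF// jacobi_functional_square_gt0.
Qed.
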